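(* Let $G$ be a finite group. Let $M_1$ be a cut cellular surface with $n$ incoming and $m>0$ outgoing boundary components, let $M_2$ be a cut cellular surface with $m$ incoming and $p$ outgoing boundary components, and let $M_2\circ M_1$ be the cut cellular surface obtained by gluing the outgoing boundary components of $M_1$ to the incoming boundary components of $M_2$. Then for all $g_1,\dots,g_n,i_1,\dots,i_p\in G$, $$\left\langle i_1,\dots,i_p\left|Z_{M_2\circ M_1}\right|g_1,\dots,g_n\right\rangle=\sum_{(h_1,\dots,h_m)\in G^m}\left\langle i_1,\dots,i_p\left|Z_{M_2}\right|h_1,\dots,h_m\right\rangle\left\langle h_1,\dots,h_m\left|Z_{M_1}\right|g_1,\dots,g_n\right\rangle .$$ Equivalently, $Z_{M_2\circ M_1}=Z_{M_2}\circ Z_{M_1}$ as linear maps.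
   Context: Cut cellular surfaces. A cut cellular surface (CCS) is an orientable 2-manifold $M$ with (possibly empty) boundary, endowed with a finite cell structure (0-, 1- and 2-cells), such that: (a) each boundary component of $M$ consists of a single 0-cell and a single 1-cell. (b) $M$ has a specified planar representation, obtained by cutting $M$ along 1-cells so as to obtain a simply connected region in the plane bounded by ''external'' 1-cells, namely the boundary 1-cells and the 1-cells along which $M$ was cut (''cut 1-cells''; each appears twice in the boundary of the planar region). The cut 1-cells are labelled and oriented to make explicit how they are identified in $M$. (c) The boundary components lie either along the bottom edge of the planar representation (the ''in'' or incoming components) or along the top edge (the ''out'' or outgoing components); when there are no in (resp. out) components, the bottom (resp. top) edge is a single 0-cell. On the left side, on the right side, and between consecutive boundary components along the bottom and top edges there are one or more cut 1-cells, separated by 0-cells when there are more than one. (d) The planar region is made up of one or more 2-cells, separated by ''internal'' 1-cells and 0-cells. Colourings and invariant. Fix a finite group $G$. Orient the 1-cells of $M$: boundary 1-cells from left to right in the planar representation, cut 1-cells as specified in (b), internal 1-cells arbitrarily. A $G$-colouring of $M$ is an assignment of an element $g_i\in G$ to each 1-cell $i$ such that for each 2-cell in the planar representation, if the 1-cells of its boundary in anticlockwise order are $i_1,\dots,i_k$, then $\prod_{j=1}^k g_{i_j}^{\pm1}=1$ (flatness), where the exponent is $+1$ if the 1-cell $i_j$ is oriented compatibly with the positive (anticlockwise) orientation of the 2-cell, and $-1$ otherwise. Suppose $M$ has $n$ in and $m$ out boundary components, ordered from left to right. Let $\mathcal C(g_1,\dots,g_n;h_1,\dots,h_m)$ be the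 set of $G$-colourings of $M$ assigning $g_1,\dots,g_n$ to the in boundary components and $h_1,\dots,h_m$ to the out boundary components, and let $v$ be the number of internal vertices of $M$ (0-cells not lying on the boundary of $M$). The invariant is $$\langle h_1,\dots,h_m|Z_M|g_1,\dots,g_n\rangle:=\frac{1}{|G|^{\frac{m+n}{2}+v}}\,\#\mathcal C(g_1,\dots,g_n;h_1,\dots,h_m),$$ with an empty list written $\emptyset$ when there are no in (or out) components. $Z_M$ denotes the linear map $V_i\to V_o$ with these matrix elements, where $V_i$ and $V_o$ are the real vector spaces with bases all $G$-colourings $|g_1,\dots,g_n\rangle$ of the in boundary and all $G$-colourings $\langle h_1,\dots,h_m|$ of the out boundary respectively. Gluing. The planar representation of $M_2$ is placed above that of $M_1$, and the $j$-th outgoing boundary component of $M_1$ (from the left) is identified with the $j$-th incoming boundary component of $M_2$, preserving the left-to-right orientation. In the planar representation of $M_2\circ M_1$, the leftmost shared boundary 1-cells are identified in the plane (becoming an internal 1-cell), and each remaining shared boundary component becomes a cut 1-cell, appearing twice in the boundary of the planar region (once from the top edge of $M_1$, once from the bottom edge of $M_2$). The incoming components of $M_2\circ M_1$ are those of $M_1$ and its outgoing components are those of $M_2$. *)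

(* Defs.v *)
From HB Require Import structures.
From mathcomp Require Import all_boot all_order all_fingroup all_algebra.
From mathcomp Require Import zify reals exp.

Set Implicit Arguments.
Unset Strict Implicit.
Unset Printing Implicit Defensive.

Import GRing.Theory.

(** * Cell structures obtained by gluing sides of polygons *)

(* A cell structure is given by its "sides".  A side is a 1-cell seen from a
   2-cell whose boundary contains it, traversed anticlockwise around that
   2-cell.  [nxt] maps a side to the next side, anticlockwise, of the same
   2-cell.  [opp] maps a side to the other side of the same 1-cell; it fixes the
   sides of the 1-cells that lie on the boundary, which have only one side.  The
   two sides of a 1-cell traverse it in opposite directions, so the result is
   an oriented surface.

   A 0-cell is the set of the sides that start at it.  The end point of a
   side [x] is the starting point of [nxt x], and [x] starts where
   [opp x] ends: when [opp x != x], the sides [x] and [nxt (opp x)] have the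
   same starting point, and these identifications generate all the others. *)

Definition corner (D : finType) (nxt opp : D -> D) : rel D :=
  [rel x y | (opp x != x) && (y == nxt (opp x))
          || (opp y != y) && (x == nxt (opp y))].

Definition classes (D : finType) (r : rel D) : {set {set D}} :=
  [set [set y | connect r x y] | x : D].

Definition cells0 (D : finType) (nxt opp : D -> D) : {set {set D}} :=
  classes (corner nxt opp).
Definition cells1 (D : finType) (opp : D -> D) : {set {set D}} :=
  classes (frel opp).
Definition cells2 (D : finType) (nxt : D -> D) : {set {set D}} :=
  classes (frel nxt).

(** * Cut cellular surfaces *)

(* [opp] describes the surface [M] itself.  The four lists give the external
   1-cells of the planar region, by their sides inside the region, each
   1-cell along which [M] was cut being listed twice (once for each side):
   [bottom] and [top] are read from left to right, [lside] and [rside] from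
   bottom to top.  [pos x] tells whether the 1-cell of [x] is oriented
   compatibly with the anticlockwise orientation of the 2-cell of [x]. *)
Record ccs_data := CCSData {
  side : finType;
  nxt : side -> side;
  opp : side -> side;
  pos : pred side;
  bottom : seq side;
  top : seq side;
  lside : seq side;
  rside : seq side }.

Section CutCellularSurface.
Variable S : ccs_data.
Local Notation D := (side S).

Definition bdry : pred D := [pred x | opp x == x].

(* The external 1-cells in anticlockwise order. *)
Definition contour : seq D :=
  bottom S ++ rside S ++ rev (top S) ++ rev (lside S).

(* In the planar region the cut 1-cells are not identified: every external
   1-cell has a single side. *)
Definition region_opp (x : D) : D := if x \in contour then x else opp x.

Definition in_sides : seq D := [seq x <- bottom S | bdry x].
Definition out_sides : seq D := [seq x <- top S | bdry x].

(* A bottom or top edge: it starts and ends with a boundary component unless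
   it is a single 0-cell, and there is at least one cut 1-cell between two
   consecutive boundary components. *)
Definition row_ok (w : seq D) : bool :=
  (if w is x :: s then bdry x && bdry (last x s) else true)
  && sorted [rel x y | ~~ (bdry x && bdry y)] w.

Definition cut_side_ok (w : seq D) : bool :=
  (w != [::]) && all (predC bdry) w.

Record is_ccs (n m : nat) : Prop := IsCCS {
  nxt_inj : injective (@nxt S);
  oppK : involutive (@opp S);
  pos_opp : forall x : D, opp x != x -> pos (opp x) = ~~ pos x;
  bottom_ok : row_ok (bottom S);
  top_ok : row_ok (top S);
  lside_ok : cut_side_ok (lside S);
  rside_ok : cut_side_ok (rside S);
  in_size : size in_sides == n;
  out_size : size out_sides == m;
  (* the boundary 1-cells are oriented from left to right *)
  in_pos : forall x : D, x \in in_sides -> pos x;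
  out_pos : forall x : D, x \in out_sides -> ~~ pos x;
  contour_uniq : uniq contour;
  bdry_contour : forall x : D, bdry x -> x \in contour;
  opp_contour : forall x : D, x \in contour -> opp x \in contour;
  (* each boundary component consists of a single 0-cell and a single 1-cell *)
  bdry_loop : forall x : D, bdry x -> connect (corner (@nxt S) (@opp S)) x (nxt x);
  (* each external 1-cell ends where the next one starts, so that the
     external 1-cells form a single closed curve *)
  contour_cycle :
    path.cycle [rel x y | connect (corner (@nxt S) region_opp) (nxt x) y] contour;
  region_connected : forall x y : D,
    connect [rel x y | (y == nxt x) || (y == region_opp x)] x y;
  (* planarity of the region, by Euler's formula: V - E + F = 2, where F counts
     the 2-cells and the exterior of the contour *)
  region_planar :
    #|cells0 (@nxt S) region_opp| + #|cells2 (@nxt S)|.+1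
    = #|cells1 region_opp| + 2 }.

(* The 0-cells of [M] that are not an end point of a boundary 1-cell. *)
Definition internal_vertices : {set {set D}} :=
  [set X in cells0 (@nxt S) (@opp S) |
     [forall b, bdry b ==> (b \notin X) && (nxt b \notin X)]].

Definition edge := {E : {set D} | E \in cells1 (@opp S)}.

Lemma edge_subproof (x : D) :
  [set y | fconnect (@opp S) x y] \in cells1 (@opp S).
Proof. exact: imset_f. Qed.

Definition edge_of (x : D) : edge :=
  exist (fun E => is_true (E \in cells1 (@opp S))) _ (edge_subproof x).

End CutCellularSurface.

Arguments bdry {S}.
Arguments edge_of {S}.
Arguments region_opp {S}.

(* Cut cellular surfaces with [n] in and [m] out boundary components. *)
Record ccs (n m : nat) := CCS {
  ccs_val :> ccs_data;
  ccs_ok : is_ccs ccs_val n m }.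

(** * Gluing *)

Section Links.
Variable T : finType.
Implicit Type r : rel T.

Definition link r (a b : T) : rel T := fun x y =>
  [|| r x y, (x == a) && (y == b) | (x == b) && (y == a)].

Lemma link_sym r a b : symmetric r -> symmetric (link r a b).
Proof.
move=> sr x y; rewrite /link sr; congr (_ || _).
by rewrite orbC andbC [in X in _ || X]andbC.
Qed.

Lemma connect_link r a b : symmetric r ->
  connect (link r a b) =2 [rel x y | [|| connect r x y,
     connect r x a && connect r b y | connect r x b && connect r a y]].
Proof.
move=> sr x y /=; have cs := sym_connect_sym sr.
have tr := @connect_trans _ r.
apply/idP/idP.
  case/connectP => p; elim: p x => [|z p IH] x /=.
    by move=> _ ->; rewrite connect0.
  case/andP=> xz /IH{}IH /IH{IH}.
  case/or3P: xz => [/connect1 xz|/andP[/eqP-> /eqP->]|/andP[/eqP-> /eqP->]].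
  - case/or3P=> [zy|/andP[za by_]|/andP[zb ay]].
    + by rewrite (tr _ _ _ xz zy).
    + by rewrite (tr _ _ _ xz za) by_ orbT.
    + by rewrite (tr _ _ _ xz zb) ay !orbT.
  - case/or3P=> [->|/andP[_ ->]|/andP[_ ->]]; by rewrite !connect0 ?orbT.
  - case/or3P=> [->|/andP[_ ->]|/andP[_ ->]]; by rewrite !connect0 ?orbT.
have sub u v : connect r u v -> connect (link r a b) u v.
  by apply: connect_sub => ? ? h; apply: connect1; rewrite /link h.
have ab : connect (link r a b) a b by apply: connect1; rewrite /link !eqxx orbT.
have ba : connect (link r a b) b a by apply: connect1; rewrite /link !eqxx !orbT.
case/or3P => [/sub//|/andP[/sub h1 /sub h2]|/andP[/sub h1 /sub h2]].
- exact: connect_trans h1 (connect_trans ab h2).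
- exact: connect_trans h1 (connect_trans ba h2).
Qed.

Lemma eq_classes r r' : connect r =2 connect r' -> classes r = classes r'.
Proof.
move=> e; apply: eq_imset => x; apply/setP=> y; by rewrite !inE e.
Qed.

Lemma card_classes_link r a b : symmetric r ->
  #|classes r| = #|classes (link r a b)| + ~~ connect r a b.
Proof.
move=> sr; have cs := sym_connect_sym sr.
have tr := @connect_trans _ r.
have cl := connect_link a b sr.
case: (boolP (connect r a b)) => [ab|nab] /=.
  rewrite addn0; congr #|pred_of_set _|; apply: eq_classes => x y; rewrite cl /=.
  case: (boolP (connect r x y)) => //= nxy; apply/esym/negbTE.
  apply: contra nxy => /orP[/andP[xa by_]|/andP[xb ay]].
    exact: tr xa (tr _ _ _ ab by_).
  by apply: tr xb (tr _ _ _ _ ay); rewrite cs.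
pose A := [set y | connect r a y]; pose B := [set y | connect r b y].
have cE x y : connect r x y -> [set z | connect r x z] = [set z | connect r y z].
  move=> xy; apply/setP=> z; rewrite !inE; exact: same_connect.
have dAB : A != B.
  apply: contra nab => /eqP/setP/(_ b); by rewrite !inE connect0.
have inA : A \in classes r by apply: imset_f.
have inB : B \in classes r by apply: imset_f.
have ABn : A :|: B \notin classes r :\ A :\ B.
  apply/negP; rewrite !inE => /and3P[_ nA /imsetP[x _ eAB]].
  case/negP: nA; rewrite eAB; apply/eqP/cE.
  have: a \in A :|: B by rewrite !inE connect0.
  by rewrite eAB inE.
suff -> : classes (link r a b) = (A :|: B) |: (classes r :\ A :\ B).
  rewrite cardsU1 ABn (cardsD1 A) inA (cardsD1 B (_ :\ A)) inE inB.
  by rewrite in_set1 eq_sym dAB /= addn1.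
have lab : connect (link r a b) a b by rewrite cl /= !connect0 orbT.
have cls := sym_connect_sym (link_sym a b sr).
have lA : [set y | connect (link r a b) a y] = A :|: B.
  apply/setP=> y; rewrite !inE cl /= connect0 /= (negbTE nab) /=.
  by rewrite orbF.
have lB : [set y | connect (link r a b) b y] = A :|: B.
  rewrite -lA; apply/setP=> y; rewrite !inE; apply: same_connect => //.
  by rewrite cls.
apply/setP=> X; rewrite !inE; apply/idP/idP.
  case/imsetP=> x _ ->.
  case: (boolP (connect r x a)) => [xa|nxa].
    apply/orP; left; rewrite -lA; apply/eqP/setP=> y; rewrite !inE.
    by apply: same_connect => //; rewrite cl /= xa.
  case: (boolP (connect r x b)) => [xb|nxb].
    apply/orP; left; rewrite -lB; apply/eqP/setP=> y; rewrite !inE.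
    by apply: same_connect => //; rewrite cl /= xb.
  have -> : [set y | connect (link r a b) x y] = [set y | connect r x y].
    by apply/setP=> y; rewrite !inE cl /= (negbTE nxa) (negbTE nxb) orbF.
  apply/orP; right; rewrite imset_f // andbT; apply/andP; split.
    by apply: contra nxb => /eqP/setP/(_ b); rewrite !inE connect0 => ->.
  by apply: contra nxa => /eqP/setP/(_ a); rewrite !inE connect0 => ->.
case/orP=> [/eqP->|/and3P[nB nA /imsetP[x _ eX]]].
  by rewrite -lA imset_f.
have nxa : ~~ connect r x a by apply: contra nA => /cE; rewrite eX => ->.
have nxb : ~~ connect r x b by apply: contra nB => /cE; rewrite eX => ->.
apply/imsetP; exists x => //; rewrite eX.
by apply/setP=> y; rewrite !inE cl /= (negbTE nxa) (negbTE nxb) orbF.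
Qed.

End Links.

Section SumRel.
Variables (T1 T2 : finType) (r1 : rel T1) (r2 : rel T2).

Definition sum_rel : rel (T1 + T2) := fun x y =>
  match x, y with
  | inl x, inl y => r1 x y
  | inr x, inr y => r2 x y
  | _, _ => false
  end.

Lemma sum_rel_sym : symmetric r1 -> symmetric r2 -> symmetric sum_rel.
Proof. by move=> s1 s2 [x|x] [y|y] /=. Qed.

Lemma connect_sum_rel x y : connect sum_rel x y =
  match x, y with
  | inl x, inl y => connect r1 x y
  | inr x, inr y => connect r2 x y
  | _, _ => false
  end.
Proof.
apply/idP/idP.
  case/connectP=> p; elim: p x => [|z p IH] x /=.
    by move=> _ ->; case: x => x; rewrite connect0.
  case/andP=> xz /IH{}IH /IH{IH}.
  case: x z xz => [x|x] [z|z] //= /connect1 xz; case: y => // y;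
    exact: connect_trans.
case: x y => [x|x] [y|y] // /connectP[p pth ->] {y}.
  elim: p x pth => [|z p IH] x //= /andP[xz /IH]; apply: connect_trans.
  exact: connect1.
elim: p x pth => [|z p IH] x //= /andP[xz /IH]; apply: connect_trans.
exact: connect1.
Qed.

Lemma card_classes_sum : #|classes sum_rel| = #|classes r1| + #|classes r2|.
Proof.
have inl_inj : injective (@inl T1 T2) by move=> ? ? [].
have inr_inj : injective (@inr T1 T2) by move=> ? ? [].
have -> : classes sum_rel = [set (@inl T1 T2) @: (X : {set T1}) | X in classes r1]
   :|: [set (@inr T1 T2) @: (X : {set T2}) | X in classes r2].
  have el x : [set y | connect sum_rel (inl x) y]
            = (@inl T1 T2) @: [set y | connect r1 x y].
    apply/setP=> [[y|y]]; rewrite inE connect_sum_rel.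
      by rewrite mem_imset // inE.
    by apply/esym/negbTE/negP=> /imsetP[? _].
  have er x : [set y | connect sum_rel (inr x) y]
            = (@inr T1 T2) @: [set y | connect r2 x y].
    apply/setP=> [[y|y]]; rewrite inE connect_sum_rel.
      by apply/esym/negbTE/negP=> /imsetP[? _].
    by rewrite mem_imset // inE.
  apply/setP=> X; rewrite inE; apply/imsetP/orP.
    case=> [[x|x] _ ->]; [left; rewrite el | right; rewrite er].
      by apply: imset_f; apply: imset_f.
    by apply: imset_f; apply: imset_f.
  case=> /imsetP[Y /imsetP[x _ ->] ->]; [exists (inl x)|exists (inr x)] => //.
rewrite cardsU disjoint_setI0 ?cards0 ?subn0.
  by rewrite (card_imset _ (imset_inj inl_inj)) (card_imset _ (imset_inj inr_inj)).
rewrite -setI_eq0; apply/eqP/setP=> X; rewrite !inE.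
apply/negP=> /andP[/imsetP[Y /imsetP[x _ ->] ->] /imsetP[Z _ /setP/(_ (inl x))]].
rewrite mem_imset // inE connect0 => /esym/imsetP[y _]; discriminate.
Qed.

End SumRel.

Section Glue.
Variables S1 S2 : ccs_data.

(* The j-th out side of [S1] becomes opposite to the j-th in side of [S2]; for
   every other side the index is out of range, which selects the default value
   of [nth]. *)
Definition glue_opp (x : side S1 + side S2) : side S1 + side S2 :=
  match x with
  | inl y => nth (inl (opp y)) (map inr (in_sides S2)) (index y (out_sides S1))
  | inr y => nth (inr (opp y)) (map inl (out_sides S1)) (index y (in_sides S2))
  end.

(* The leftmost glued 1-cell becomes internal: when there is at least one
   glued component it is the head of [top S1] and of [bottom S2].  The other
   1-cells of these two edges become cut 1-cells on the right side. *)
Definition glue_data : ccs_data := {|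
  side := (side S1 + side S2)%type;
  nxt := fun x => match x with
                  | inl y => inl (nxt y)
                  | inr y => inr (nxt y)
                  end;
  opp := glue_opp;
  pos := fun x => match x with inl y => pos y | inr y => pos y end;
  bottom := map inl (bottom S1);
  top := map inr (top S2);
  lside := map inl (lside S1) ++ map inr (lside S2);
  rside := map inl (rside S1) ++ map inl (rev (behead (top S1)))
           ++ map inr (behead (bottom S2)) ++ map inr (rside S2) |}.

End Glue.

Section CornerTheory.
Variables (D : finType) (nxt opp : D -> D).

Lemma cornerE x y : corner nxt opp x y =
  (opp x != x) && (y == nxt (opp x)) || (opp y != y) && (x == nxt (opp y)).
Proof. by []. Qed.

Lemma corner_sym : symmetric (corner nxt opp).
Proof. by move=> x y; rewrite /corner /= orbC. Qed.

Lemma corner_csym : connect_sym (corner nxt opp).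
Proof. exact: sym_connect_sym corner_sym. Qed.

(* At most one side without an opposite starts at a given 0-cell. *)
Lemma corner_bdry_uniq x y : injective nxt -> involutive opp ->
  opp x = x -> opp y = y -> connect (corner nxt opp) x y -> x = y.
Proof.
move=> nxtI oppK ox oy.
pose s z := if opp z == z then z else nxt (opp z).
have key z : connect (corner nxt opp) x z -> exists k, iter k s z = x.
  case/connectP=> p; elim/last_ind: p z => [|p w IH] z /=.
    by move=> _ ->; exists 0.
  rewrite rcons_path last_rcons => /andP[/IH/(_ erefl) [k kx] h] ->{z}.
  set l := last x p in h kx; case/orP: h => /andP[h /eqP e].
    case: k kx => [|k] kx; last first.
      by exists k; rewrite -kx iterSr /s (negbTE h) -e.
    by move: h; rewrite (kx : l = x) ox eqxx.
  by exists k.+1; rewrite iterSr /s (negbTE h) -e.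
move=> /key[k <-]; elim: k => //= k ->.
by rewrite /s oy eqxx.
Qed.

End CornerTheory.

Lemma euler_glue (a a1 a2 f f1 f2 e e1 e2 : nat) :
  a1 + a2 = a + 2 -> f1 + f2 = f -> e1 + e2 = e + 1 ->
  a1 + f1.+1 = e1 + 2 -> a2 + f2.+1 = e2 + 2 -> a + f.+1 = e + 2.
Proof. lia. Qed.

Lemma region_oppK (S : ccs_data) (n m : nat) :
  is_ccs S n m -> involutive (@region_opp S).
Proof.
move=> ok x; rewrite {2}/region_opp.
case: (boolP (x \in contour S)) => xc; rewrite /region_opp ?xc // ifN ?(oppK ok) //.
by apply: contra xc => /(opp_contour ok); rewrite (oppK ok).
Qed.

Section GlueOk.
Variables (S1 S2 : ccs_data) (n m p : nat).
Hypotheses (m_gt0 : 0 < m) (ok1 : is_ccs S1 n m) (ok2 : is_ccs S2 m p).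
Local Notation S := (glue_data S1 S2).
Local Notation D1 := (side S1).
Local Notation D2 := (side S2).
Local Notation D := (D1 + D2)%type.

Let L : D1 -> side S := inl.
Let R : D2 -> side S := inr.
Let L_inj : injective L. Proof. by move=> ? ? []. Qed.
Let R_inj : injective R. Proof. by move=> ? ? []. Qed.

Let mem_LR x (s : seq D2) : (L x \in map R s) = false.
Proof. by apply/negP=> /mapP[]. Qed.
Let mem_RL x (s : seq D1) : (R x \in map L s) = false.
Proof. by apply/negP=> /mapP[]. Qed.
Let mem_LL x (s : seq D1) : (L x \in map L s) = (x \in s).
Proof. exact: mem_map. Qed.
Let mem_RR x (s : seq D2) : (R x \in map R s) = (x \in s).
Proof. exact: mem_map. Qed.

Let size_io : size (in_sides S2) = size (out_sides S1).
Proof. by rewrite (eqP (in_size ok2)) (eqP (out_size ok1)). Qed.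

Let uniq_top : uniq (top S1).
Proof.
have := contour_uniq ok1; rewrite /contour !cat_uniq rev_uniq.
by case/and3P=> _ _ /and3P[_ _ /andP[->]].
Qed.
Let uniq_bot : uniq (bottom S2).
Proof. by have := contour_uniq ok2; rewrite /contour cat_uniq => /andP[]. Qed.
Let uniq_out : uniq (out_sides S1). Proof. exact: filter_uniq. Qed.
Let uniq_in : uniq (in_sides S2). Proof. exact: filter_uniq. Qed.

Lemma glue_oppLn x : x \notin out_sides S1 -> opp (L x) = L (opp x).
Proof. 
move=> h; rewrite /= nth_default // size_map size_io.
by rewrite leqNgt index_mem.
Qed.

Lemma glue_oppRn x : x \notin in_sides S2 -> opp (R x) = R (opp x).
Proof. 
move=> h; rewrite /= nth_default // size_map -size_io.
by rewrite leqNgt index_mem.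
Qed.

Lemma glue_oppLP x : x \in out_sides S1 ->
  exists2 y, y \in in_sides S2 & opp (L x) = R y /\ opp (R y) = L x.
Proof.
move=> xo; have := xo; rewrite -index_mem -size_io => h.
have y0 : D2 by case: (in_sides S2) h.
exists (nth y0 (in_sides S2) (index x (out_sides S1))); first exact: mem_nth.
rewrite /=; split; first by rewrite (nth_map y0).
by rewrite index_uniq // (nth_map x) ?index_mem // nth_index.
Qed.

Lemma glue_oppRP y : y \in in_sides S2 ->
  exists2 x, x \in out_sides S1 & opp (L x) = R y /\ opp (R y) = L x.
Proof.
move=> xo; have := xo; rewrite -index_mem size_io => h.
have x0 : D1 by case: (out_sides S1) h.
exists (nth x0 (out_sides S1) (index y (in_sides S2))); first exact: mem_nth.
rewrite /=; split; last by rewrite (nth_map x0).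
by rewrite index_uniq // (nth_map y) ?index_mem // nth_index.
Qed.

Let out_bdry x : x \in out_sides S1 -> opp x = x.
Proof. by rewrite mem_filter => /andP[/eqP]. Qed.
Let in_bdry y : y \in in_sides S2 -> opp y = y.
Proof. by rewrite mem_filter => /andP[/eqP]. Qed.

Let glue_nxt_inj : injective (@nxt S).
Proof.
by move=> [x|x] [y|y] // [] => [/(nxt_inj ok1)|/(nxt_inj ok2)] ->.
Qed.

Let glue_oppK : involutive (@opp S).
Proof.
case=> [x|y]; rewrite -/(L _) -/(R _).
  case: (boolP (x \in out_sides S1)) => [/glue_oppLP[y _ [-> ->]] //|h].
  rewrite (glue_oppLn h) glue_oppLn ?(oppK ok1) //.
  apply: contra h => h; by rewrite -(oppK ok1 x) (out_bdry h).
case: (boolP (y \in in_sides S2)) => [/glue_oppRP[x _ [e1 e2]]|h]; first by rewrite e2 e1.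
rewrite (glue_oppRn h) glue_oppRn ?(oppK ok2) //.
apply: contra h => h; by rewrite -(oppK ok2 y) (in_bdry h).
Qed.

Let glue_bdryL x : bdry (L x) = bdry x && (x \notin out_sides S1).
Proof.
have -> : bdry (L x) = (opp (L x) == L x) by [].
case: (boolP (x \in out_sides S1)) => [/glue_oppLP[y _ [e _]]|h].
  by rewrite andbF e.
by rewrite andbT glue_oppLn // (inj_eq L_inj).
Qed.

Let glue_bdryR y : bdry (R y) = bdry y && (y \notin in_sides S2).
Proof.
have -> : bdry (R y) = (opp (R y) == R y) by [].
case: (boolP (y \in in_sides S2)) => [/glue_oppRP[x _ [_ e]]|h].
  by rewrite andbF e.
by rewrite andbT glue_oppRn // (inj_eq R_inj).
Qed.

Let glue_pos_opp (x : side S) : opp x != x -> pos (opp x) = ~~ pos x.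
Proof.
case: x => [x|y]; rewrite -/(L _) -/(R _).
  case: (boolP (x \in out_sides S1)) => [xo|h].
    have [y yi [-> _] _] := glue_oppLP xo.
    by rewrite /= (in_pos ok2 yi) (out_pos ok1 xo).
  rewrite (glue_oppLn h) => e; apply: (pos_opp ok1).
  by apply: contra e => /eqP->.
case: (boolP (y \in in_sides S2)) => [yi|h].
  have [x xo [_ ->] _] := glue_oppRP yi.
  by rewrite /= (in_pos ok2 yi) (negbTE (out_pos ok1 xo)).
rewrite (glue_oppRn h) => e; apply: (pos_opp ok2).
by apply: contra e => /eqP->.
Qed.

Let bot_notin_out x : x \in bottom S1 -> x \notin out_sides S1.
Proof.
move=> xb; rewrite mem_filter; apply/negP=> /andP[_ xt].
have := contour_uniq ok1; rewrite /contour cat_uniq => /and3P[_ /hasPn/(_ x) + _].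
by rewrite !mem_cat mem_rev xt orbT => /(_ isT); rewrite /= xb.
Qed.

Let top_notin_in x : x \in top S2 -> x \notin in_sides S2.
Proof.
move=> xt; rewrite mem_filter; apply/negP=> /andP[_ xb].
have := contour_uniq ok2; rewrite /contour cat_uniq => /and3P[_ /hasPn/(_ x) + _].
by rewrite !mem_cat mem_rev xt orbT => /(_ isT); rewrite /= xb.
Qed.

Let bdry_bot x : x \in bottom S1 -> bdry (L x) = bdry x.
Proof. by move=> /bot_notin_out h; rewrite glue_bdryL h andbT. Qed.
Let bdry_top x : x \in top S2 -> bdry (R x) = bdry x.
Proof. by move=> /top_notin_in h; rewrite glue_bdryR h andbT. Qed.

Let row_map (S0 : ccs_data) (f : side S0 -> side S) (w : seq (side S0)) :
  {in w, forall x, bdry (f x) = bdry x} -> row_ok w -> row_ok (map f w).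
Proof.
move=> e /andP[h1 h2]; apply/andP; split.
  case: w e h1 {h2} => //= x w e; rewrite last_map !e ?mem_head //.
  exact: mem_last.
rewrite sorted_map; move: h2; apply: sub_in_sorted => // x y /e ex /e ey.
by rewrite /= ex ey.
Qed.

Let glue_in : in_sides S = map L (in_sides S1).
Proof.
rewrite /in_sides /= filter_map; congr map; apply: eq_in_filter => x.
exact: bdry_bot.
Qed.
Let glue_out : out_sides S = map R (out_sides S2).
Proof.
rewrite /out_sides /= filter_map; congr map; apply: eq_in_filter => x.
exact: bdry_top.
Qed.

Let topE : exists t w, top S1 = t :: w /\ bdry t.
Proof.
move: (eqP (out_size ok1)) (top_ok ok1); rewrite /out_sides.
case: (top S1) => [|t w]; first by move=> /= m0; move: m_gt0; rewrite -m0.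
by move=> _ /andP[/andP[bt _] _]; exists t, w.
Qed.
Let botE : exists t w, bottom S2 = t :: w /\ bdry t.
Proof.
move: (eqP (in_size ok2)) (bottom_ok ok2); rewrite /in_sides.
case: (bottom S2) => [|t w]; first by move=> /= m0; move: m_gt0; rewrite -m0.
by move=> _ /andP[/andP[bt _] _]; exists t, w.
Qed.

Section Main.
Variables (t : D1) (tw : seq D1) (b : D2) (bw : seq D2).
Hypotheses (topt : top S1 = t :: tw) (bt : bdry t).
Hypotheses (botb : bottom S2 = b :: bw) (bb : bdry b).

Let outE : out_sides S1 = t :: [seq x <- tw | bdry x].
Proof. by rewrite /out_sides topt /= bt. Qed.
Let inE' : in_sides S2 = b :: [seq x <- bw | bdry x].
Proof. by rewrite /in_sides botb /= bb. Qed.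
Let opp_t : opp (L t) = R b.
Proof. by rewrite /= outE inE' /= eqxx. Qed.
Let opp_b : opp (R b) = L t.
Proof. by rewrite /= outE inE' /= eqxx. Qed.


Let u := rev (lside S1) ++ (bottom S1 ++ rside S1 ++ rev tw).
Let v := bw ++ rside S2 ++ rev (top S2) ++ rev (lside S2).

Let contour1 : exists k, contour S1 = rot k (t :: u).
Proof.
exists (size (t :: rev (lside S1))); rewrite /u -cat_cons rot_size_cat.
by rewrite /contour topt rev_cons -cats1 -!catA.
Qed.
Let contour2 : contour S2 = b :: v.
Proof. by rewrite /contour botb. Qed.
Let contourS : exists k, contour S = rot k (map L u ++ map R v).
Proof.
exists (size (map L (rev (lside S1)))); rewrite /u map_cat -catA rot_size_cat.
by rewrite /contour /= topt botb /= rev_cat /v !map_cat -!map_rev -?catA.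
Qed.

Let mem1 x : (x \in contour S1) = (x == t) || (x \in u).
Proof. by have [k ->] := contour1; rewrite mem_rot inE. Qed.
Let mem2 x : (x \in contour S2) = (x == b) || (x \in v).
Proof. by rewrite contour2 inE. Qed.
Let memSL x : (L x \in contour S) = (x \in u).
Proof. by have [k ->] := contourS; rewrite mem_rot mem_cat mem_LL mem_LR orbF. Qed.
Let memSR x : (R x \in contour S) = (x \in v).
Proof. by have [k ->] := contourS; rewrite mem_rot mem_cat mem_RR mem_RL. Qed.
Let uniq1 : (t \notin u) && uniq u.
Proof. by have [k e] := contour1; have := contour_uniq ok1; rewrite e rot_uniq. Qed.
Let uniq2 : (b \notin v) && uniq v.
Proof. by have := contour_uniq ok2; rewrite contour2. Qed.

Let ropL x : region_opp (L x) = if x == t then R b else L (region_opp x).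
Proof.
rewrite /region_opp memSL mem1; have [->|xt] := eqVneq x t; rewrite ?orTb ?orFb.
  by have /andP[/negbTE-> _] := uniq1; rewrite opp_t.
case: (boolP (x \in u)) => // xu; rewrite glue_oppLn //.
apply/negP=> h; case/negP: xu; have := bdry_contour ok1.
move=> /(_ x); rewrite mem1 (negbTE xt) /=; apply; exact/eqP/out_bdry.
Qed.
Let ropR x : region_opp (R x) = if x == b then L t else R (region_opp x).
Proof.
rewrite /region_opp memSR mem2; have [->|xt] := eqVneq x b; rewrite ?orTb ?orFb.
  by have /andP[/negbTE-> _] := uniq2; rewrite opp_b.
case: (boolP (x \in v)) => // xu; rewrite glue_oppRn //.
apply/negP=> h; case/negP: xu; have := bdry_contour ok2.
move=> /(_ x); rewrite mem2 (negbTE xt) /=; apply; exact/eqP/in_bdry.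
Qed.
Let rop_t : region_opp t = t. Proof. by rewrite /region_opp mem1 eqxx. Qed.
Let rop_b : region_opp b = b. Proof. by rewrite /region_opp mem2 eqxx. Qed.

Let r1 := corner (@nxt S1) region_opp.
Let r2 := corner (@nxt S2) region_opp.
Let rS := corner (@nxt S) region_opp.

Let nxtL x : nxt (L x) = L (nxt x). Proof. by []. Qed.
Let nxtR x : nxt (R x) = R (nxt x). Proof. by []. Qed.
Let eqLR x y : (L x == R y) = false. Proof. by []. Qed.
Let eqRL x y : (R x == L y) = false. Proof. by []. Qed.
Let eqLL x y : (L x == L y) = (x == y). Proof. exact: (inj_eq L_inj). Qed.
Let eqRR x y : (R x == R y) = (x == y). Proof. exact: (inj_eq R_inj). Qed.
Let eqS := (eqLR, eqRL, eqLL, eqRR, nxtL, nxtR, eqxx).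

Let corner_glue :
  rS =2 link (link (sum_rel r1 r2) (L t) (R (nxt b))) (R b) (L (nxt t)).
Proof.
move=> [x|x] [y|y]; rewrite /rS /link /sum_rel /r1 /r2 -/(L _) -/(R _);
  rewrite !cornerE ?ropL ?ropR -/(L _) -/(R _).
- have [->|xt] := eqVneq x t; have [->|yt] := eqVneq y t;
    by rewrite ?rop_t !eqS /= ?andbF ?orbF.
- have [->|xt] := eqVneq x t; have [->|yt] := eqVneq y b;
    by rewrite ?rop_t ?rop_b !eqS /= ?(negbTE xt) ?(negbTE yt) ?andbF ?andbT ?orbF //=.
- have [->|xt] := eqVneq x b; have [->|yt] := eqVneq y t;
    rewrite ?rop_t ?rop_b !eqS /= ?(negbTE xt) ?(negbTE yt) ?andbF ?andbT ?orbF //=.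
  by rewrite orbC.
- have [->|xt] := eqVneq x b; have [->|yt] := eqVneq y b;
    by rewrite ?rop_b !eqS /= ?andbF ?orbF.
Qed.

Let r1_sym : symmetric r1. Proof. exact: corner_sym. Qed.
Let r2_sym : symmetric r2. Proof. exact: corner_sym. Qed.
Let r12_sym : symmetric (sum_rel r1 r2). Proof. exact: sum_rel_sym. Qed.

Let rS_L x y : connect r1 x y -> connect rS (L x) (L y).
Proof.
move=> h; have: connect (sum_rel r1 r2) (L x) (L y) by rewrite connect_sum_rel.
by apply: connect_sub => ? ? e; apply: connect1; rewrite corner_glue /link e.
Qed.
Let rS_R x y : connect r2 x y -> connect rS (R x) (R y).
Proof.
move=> h; have: connect (sum_rel r1 r2) (R x) (R y) by rewrite connect_sum_rel.
by apply: connect_sub => ? ? e; apply: connect1; rewrite corner_glue /link e.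
Qed.
Let rS_t : connect rS (L t) (R (nxt b)).
Proof. by apply: connect1; rewrite corner_glue /link !eqxx !orbT. Qed.
Let rS_b : connect rS (R b) (L (nxt t)).
Proof. by apply: connect1; rewrite corner_glue /link !eqxx !orbT. Qed.

Let cyc1 : path.cycle [rel x y | connect r1 (nxt x) y] (t :: u).
Proof.
by have [k e] := contour1; have := contour_cycle ok1; rewrite e rot_cycle.
Qed.
Let cyc2 : path.cycle [rel x y | connect r2 (nxt x) y] (b :: v).
Proof. by have := contour_cycle ok2; rewrite contour2. Qed.

Let uE : exists x0 u', u = x0 :: u'.
Proof.
have /andP[] := rside_ok ok1; have: {subset rside S1 <= u}.
  by move=> x; rewrite !mem_cat => ->; rewrite !orbT.
case: (rside S1) => // x s /(_ x (mem_head _ _)) + _ _.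
by case: u => // x0 u' _; exists x0, u'.
Qed.
Let vE : exists x0 v', v = x0 :: v'.
Proof.
have /andP[] := rside_ok ok2; have: {subset rside S2 <= v}.
  by move=> x; rewrite !mem_cat => ->; rewrite !orbT.
case: (rside S2) => // x s /(_ x (mem_head _ _)) + _ _.
by case: v => // x0 v' _; exists x0, v'.
Qed.

Let glue_cycle : path.cycle [rel x y | connect rS (nxt x) y] (contour S).
Proof.
have [k ->] := contourS; rewrite rot_cycle.
have [x0 [u' eu]] := uE; have [y0 [v' ev]] := vE.
have := cyc1; have := cyc2; rewrite eu ev /=.
rewrite rcons_cat cat_path last_map /= !rcons_path last_map.
move=> /and3P[h1 h2 h3] /and3P[h4 h5 h6].
apply/and3P; split.
- rewrite path_map; apply: sub_path h5 => x y; exact: rS_L.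
- apply: (connect_trans (y := L t)); first exact: rS_L.
  apply: connect_trans rS_t _; exact: rS_R.
apply/andP; split.
  rewrite path_map; apply: sub_path h2 => x y; exact: rS_R.
apply: (connect_trans (y := R b)); first exact: rS_R.
apply: connect_trans rS_b _; exact: rS_L.
Qed.

Let glue_connected (x y : side S) :
  connect [rel x y | (y == nxt x) || (y == region_opp x)] x y.
Proof.
set rc := [rel _ _ | _].
have cL (z w : D1) : connect rc (L z) (L w).
  have := region_connected ok1 z w; case/connectP=> q pth ->.
  elim: q z pth => [|a q IH] z //= /andP[/orP[] /eqP e /IH]; rewrite e;
    apply: connect_trans.
    by apply: connect1; rewrite /rc /= !eqS.
  have [->|zt] := eqVneq z t; first by rewrite rop_t connect0.
  by apply: connect1; rewrite /rc /= ropL (negbTE zt) !eqS orbT.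
have cR (z w : D2) : connect rc (R z) (R w).
  have := region_connected ok2 z w; case/connectP=> q pth ->.
  elim: q z pth => [|a q IH] z //= /andP[/orP[] /eqP e /IH]; rewrite e;
    apply: connect_trans.
    by apply: connect1; rewrite /rc /= !eqS.
  have [->|zt] := eqVneq z b; first by rewrite rop_b connect0.
  by apply: connect1; rewrite /rc /= ropR (negbTE zt) !eqS orbT.
have tb : connect rc (L t) (R b).
  by apply: connect1; rewrite /rc /= ropL !eqxx ?orbT.
have bt' : connect rc (R b) (L t).
  by apply: connect1; rewrite /rc /= ropR !eqxx ?orbT.
case: x y => [x|x] [y|y]; rewrite -/(L _) -/(R _).
- exact: cL.
- exact: connect_trans (cL _ _) (connect_trans tb (cR _ _)).
- exact: connect_trans (cR _ _) (connect_trans bt' (cL _ _)).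
- exact: cR.
Qed.

Let rop1K : involutive (@region_opp S1). Proof. exact: region_oppK ok1. Qed.
Let rop2K : involutive (@region_opp S2). Proof. exact: region_oppK ok2. Qed.

Let b_loop : connect r2 b (nxt b) = false.
Proof.
apply/negP=> h; have [y0 [v' ev]] := vE.
have := cyc2; rewrite ev /= => /andP[nby _].
have := uniq2; rewrite ev inE negb_or => /andP[/andP[/eqP nb _] _]; case: nb.
apply: (corner_bdry_uniq (nxt_inj ok2) rop2K rop_b) (connect_trans h nby).
by rewrite /region_opp mem2 ev mem_head orbT.
Qed.

Let cells0_glue : #|cells0 (@nxt S1) region_opp| + #|cells0 (@nxt S2) region_opp|
  = #|cells0 (@nxt S) region_opp| + 2.
Proof.
rewrite /cells0 -/r1 -/r2 -/rS.
rewrite (@eq_classes _ rS _ (eq_connect corner_glue)) -card_classes_sum.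
rewrite (card_classes_link (L t) (R (nxt b)) r12_sym).
rewrite (card_classes_link (R b) (L (nxt t))); last exact: link_sym.
have e1 : connect (sum_rel r1 r2) (L t) (R (nxt b)) = false.
  by rewrite connect_sum_rel.
have e2 : connect (sum_rel r1 r2) (R b) (L (nxt t)) = false.
  by rewrite connect_sum_rel.
have e3 : connect (sum_rel r1 r2) (R b) (L t) = false.
  by rewrite connect_sum_rel.
have e4 : connect (sum_rel r1 r2) (R b) (R (nxt b)) = false.
  by rewrite connect_sum_rel.
rewrite (connect_link (L t) (R (nxt b)) r12_sym (R b) (L (nxt t))) [LHS]/=.
by rewrite e1 e2 e3 e4 -addnA.
Qed.

Let cells2_glue : #|cells2 (@nxt S1)| + #|cells2 (@nxt S2)| = #|cells2 (@nxt S)|.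
Proof.
rewrite -card_classes_sum /cells2; congr #|pred_of_set _|; apply: eq_classes.
apply: eq_connect => [[x|x] [y|y]]; rewrite /= -/(L _) -/(R _) ?eqS //.
Qed.

Let cells1_glue : #|cells1 (@region_opp S1)| + #|cells1 (@region_opp S2)|
  = #|cells1 (@region_opp S)| + 1.
Proof.
pose s := sum_rel (frel (@region_opp S1)) (frel (@region_opp S2)).
have fsym (T : finType) (f : T -> T) : involutive f -> symmetric (frel f).
  by move=> fK x y /=; rewrite -{1}(fK y) (inj_eq (inv_inj fK)) eq_sym.
have ssym : symmetric s by apply: sum_rel_sym; apply: fsym.
have e : connect (frel (@region_opp S)) =2 connect (link s (L t) (R b)).
  move=> x y; apply/idP/idP; apply: connect_sub => {x y} x y.
    move=> /eqP <-; apply: connect1; case: x => x; rewrite -/(L _) -/(R _).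
      rewrite ropL; have [->|xt] := eqVneq x t; first by rewrite /link !eqxx orbT.
      by rewrite /link /= eqxx.
    rewrite ropR; have [->|xt] := eqVneq x b; first by rewrite /link !eqxx !orbT.
    by rewrite /link /= eqxx.
  case/or3P=> [|/andP[/eqP-> /eqP->]|/andP[/eqP-> /eqP->]].
  - case: x y => [x|x] [y|y] //= /eqP <-; rewrite -/(L _) -/(R _).
      have [->|xt] := eqVneq x t; first by rewrite rop_t connect0.
      by apply: connect1; rewrite /= ropL (negbTE xt).
    have [->|xt] := eqVneq x b; first by rewrite rop_b connect0.
    by apply: connect1; rewrite /= ropR (negbTE xt).
  - by apply: connect1; rewrite /= ropL eqxx.
  - by apply: connect1; rewrite /= ropR eqxx.
rewrite /cells1 (eq_classes e) -card_classes_sum -/s.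
by rewrite (card_classes_link (L t) (R b) ssym) connect_sum_rel.
Qed.

Let glue_planar :
  #|cells0 (@nxt S) region_opp| + #|cells2 (@nxt S)|.+1
  = #|cells1 (@region_opp S)| + 2.
Proof.
exact: euler_glue cells0_glue cells2_glue cells1_glue
  (region_planar ok1) (region_planar ok2).
Qed.

Let glue_contour_uniq : uniq (contour S).
Proof.
have [k ->] := contourS; rewrite rot_uniq cat_uniq !map_inj_uniq //.
have /andP[_ ->] := uniq1; have /andP[_ ->] := uniq2; rewrite andbT /=.
by apply/hasPn=> _ /mapP[y _ ->] /=; rewrite mem_RL.
Qed.

Let glue_bdry_contour (x : side S) : bdry x -> x \in contour S.
Proof.
case: x => x; rewrite -/(L _) -/(R _).
  rewrite glue_bdryL memSL => /andP[/(bdry_contour ok1)]; rewrite mem1.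
  by case/orP=> [/eqP->|//]; rewrite outE mem_head.
rewrite glue_bdryR memSR => /andP[/(bdry_contour ok2)]; rewrite mem2.
by case/orP=> [/eqP->|//]; rewrite inE' mem_head.
Qed.

Let glue_opp_contour (x : side S) : x \in contour S -> opp x \in contour S.
Proof.
have ut (z : D1) : z \in u -> z != t.
  by move=> zu; have /andP[+ _] := uniq1; apply: contra => /eqP<-.
have vb (z : D2) : z \in v -> z != b.
  by move=> zu; have /andP[+ _] := uniq2; apply: contra => /eqP<-.
have e1 (z : D1) : z \in u -> opp z \in u.
  move=> zu; have: opp z \in contour S1 by rewrite (opp_contour ok1) // mem1 zu orbT.
  rewrite mem1 => /orP[/eqP e|//]; move: (ut _ zu).
  by rewrite -(oppK ok1 z) e (eqP bt) eqxx.
have e2 (z : D2) : z \in v -> opp z \in v.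
  move=> zu; have: opp z \in contour S2 by rewrite (opp_contour ok2) // mem2 zu orbT.
  rewrite mem2 => /orP[/eqP e|//]; move: (vb _ zu).
  by rewrite -(oppK ok2 z) e (eqP bb) eqxx.
have o1 (z : D1) : z \in out_sides S1 -> z \in contour S1.
  by move/out_bdry/eqP/(bdry_contour ok1).
have o2 (z : D2) : z \in in_sides S2 -> z \in contour S2.
  by move/in_bdry/eqP/(bdry_contour ok2).
case: x => x; rewrite -/(L _) -/(R _).
  rewrite memSL => xu; case: (boolP (x \in out_sides S1)) => [xo|h].
    have [y yi [-> ey]] := glue_oppLP xo; rewrite memSR.
    have := o2 _ yi; rewrite mem2 => /orP[/eqP e|//].
    move: ey; rewrite e opp_b => -[e']; by move: (ut _ xu); rewrite e' eqxx.
  by rewrite glue_oppLn // memSL e1.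
rewrite memSR => xu; case: (boolP (x \in in_sides S2)) => [xo|h].
  have [y yi [ey ->]] := glue_oppRP xo; rewrite memSL.
  have := o1 _ yi; rewrite mem1 => /orP[/eqP e|//].
  move: ey; rewrite e opp_t => -[e']; by move: (vb _ xu); rewrite e' eqxx.
by rewrite glue_oppRn // memSR e2.
Qed.

Let glue_bdry_loop (x : side S) :
  bdry x -> connect (corner (@nxt S) (@opp S)) x (nxt x).
Proof.
case: x => x; rewrite -/(L _) -/(R _).
  rewrite glue_bdryL => /andP[bx _].
  have := bdry_loop ok1 bx; rewrite nxtL; move: (nxt x) => y /connectP[q].
  elim: q x {bx} => [|a q IH] x /=; first by move=> _ ->; rewrite connect0.
  case/andP=> xa /IH{}IH /IH; apply: connect_trans; apply: connect1.
  have no (z : D1) : opp z != z -> z \notin out_sides S1.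
    by apply: contra => /out_bdry->.
  case/orP: xa => /andP[n1 e]; rewrite cornerE !(glue_oppLn (no _ n1)).
    by rewrite !eqS n1 e.
  by rewrite !eqS n1 e orbT.
rewrite glue_bdryR => /andP[bx _].
have := bdry_loop ok2 bx; rewrite nxtR; move: (nxt x) => y /connectP[q].
elim: q x {bx} => [|a q IH] x /=; first by move=> _ ->; rewrite connect0.
case/andP=> xa /IH{}IH /IH; apply: connect_trans; apply: connect1.
have no (z : D2) : opp z != z -> z \notin in_sides S2.
  by apply: contra => /in_bdry->.
case/orP: xa => /andP[n1 e]; rewrite cornerE !(glue_oppRn (no _ n1)).
  by rewrite !eqS n1 e.
by rewrite !eqS n1 e orbT.
Qed.

Let bdryS1 (x : D1) : ~~ bdry x -> ~~ bdry (L x).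
Proof. by rewrite glue_bdryL negb_and => ->. Qed.
Let bdryS2 (x : D2) : ~~ bdry x -> ~~ bdry (R x).
Proof. by rewrite glue_bdryR negb_and => ->. Qed.

Let glue_lside : cut_side_ok (lside S).
Proof.
have /andP[n1 /allP a1] := lside_ok ok1; have /andP[_ /allP a2] := lside_ok ok2.
apply/andP; split; first by rewrite /=; case: (lside S1) n1.
apply/allP=> x; rewrite mem_cat => /orP[] /mapP[y yl ->].
  exact/bdryS1/a1.
exact/bdryS2/a2.
Qed.

Let glue_rside : cut_side_ok (rside S).
Proof.
have /andP[n1 /allP a1] := rside_ok ok1; have /andP[_ /allP a2] := rside_ok ok2.
apply/andP; split; first by rewrite /=; case: (rside S1) n1.
apply/allP=> x; rewrite /= !mem_cat topt botb /= => /or4P[] /mapP[y yl ->].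
- exact/bdryS1/a1.
- change (~~ bdry (L y)); rewrite glue_bdryL negb_and negbK.
  by case: (boolP (bdry y)) => //= by_; rewrite outE inE mem_filter by_ -mem_rev yl orbT.
- change (~~ bdry (R y)); rewrite glue_bdryR negb_and negbK.
  by case: (boolP (bdry y)) => //= by_; rewrite inE' inE mem_filter by_ yl orbT.
- exact/bdryS2/a2.
Qed.

Lemma glue_ok_aux : is_ccs S n p.
Proof.
split=> //.
- exact: row_map bdry_bot (bottom_ok ok1).
- exact: row_map bdry_top (top_ok ok2).
- by rewrite glue_in size_map (in_size ok1).
- by rewrite glue_out size_map (out_size ok2).
- by move=> x; rewrite glue_in => /mapP[y /(in_pos ok1) h ->].
- by move=> x; rewrite glue_out => /mapP[y /(out_pos ok2) h ->].
Qed.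

End Main.

Lemma glue_ok : is_ccs S n p.
Proof.
have [t [tw [et bt]]] := topE; have [b [bw [eb bb]]] := botE.
exact: glue_ok_aux et bt eb bb.
Qed.

End GlueOk.

Definition glue (n m p : nat) (m_gt0 : 0 < m) (M2 : ccs m p) (M1 : ccs n m) :
  ccs n p := CCS (glue_ok m_gt0 (ccs_ok M1) (ccs_ok M2)).

(** * Colourings and the invariant *)

Section Colourings.
Variables (gT : finGroupType) (S : ccs_data).

(* The contribution of a side to the boundary product of its 2-cell. *)
Definition signed_colour (c : {ffun edge S -> gT}) (x : side S) : gT :=
  if pos x then c (edge_of x) else ((c (edge_of x))^-1)%g.

(* Each 2-cell is read once from each of its sides; the resulting conditions
   are conjugate to each other. *)
Definition is_colouring (c : {ffun edge S -> gT}) : bool :=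
  [forall x : side S,
     (\prod_(y <- fingraph.orbit (@nxt S) x) signed_colour c y == 1)%g].

Definition colourings (g h : seq gT) : {set {ffun edge S -> gT}} :=
  [set c | [&& is_colouring c,
               [seq c (edge_of x) | x <- in_sides S] == g
             & [seq c (edge_of x) | x <- out_sides S] == h]].

End Colourings.

Local Open Scope ring_scope.

(* The matrix element < h | Z_M | g >. *)
Definition matrix_elt (R : realType) (gT : finGroupType) (n m : nat)
    (h : m.-tuple gT) (M : ccs n m) (g : n.-tuple gT) : R :=
  (#|gT|%:R `^ ((m + n)%:R / 2 + #|internal_vertices M|%:R))^-1
  * #|colourings M g h|%:R.

(* The real vector space with basis the colourings of n boundary components,
   as the space of coordinate vectors. *)
Definition boundary_space (R : realType) (gT : finGroupType) (n : nat) :=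
  {ffun n.-tuple gT -> R^o}.

Section LinearMap.
Variables (R : realType) (gT : finGroupType) (n m : nat) (M : ccs n m).

Definition Z (u : boundary_space R gT n) : boundary_space R gT m :=
  [ffun h => \sum_g matrix_elt R h M g * u g].

Fact Z_is_linear : linear Z.
Proof.
move=> a u v; apply/ffunP=> h; rewrite !ffunE scaler_sumr -big_split /=.
by apply: eq_bigr => g _; rewrite !ffunE mulrDr scalerAr.
Qed.

HB.instance Definition _ := GRing.isLinear.Build R
  (boundary_space R gT n) (boundary_space R gT m) _ Z Z_is_linear.

End LinearMap.

(* Main.v *)
(* Reading a colouring off the sides, a colouring of the glued surface is a
   pair of colourings of the two pieces that agree on the glued 1-cells; sorting
   these pairs by the common colours [h] gives the sum.  For the normalisation,
   every boundary component carries exactly one 0-cell, so each of the [m] glued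
   components turns two boundary 0-cells into one internal 0-cell, and
   (m + n) / 2 + v1 + (p + m) / 2 + v2 = (p + n) / 2 + (v1 + v2 + m). *)

Require Import Defs.
From mathcomp Require Import all_boot all_order all_fingroup all_algebra.
From mathcomp Require Import reals exp.
From mathcomp Require Import zify ring.

Set Implicit Arguments.
Unset Strict Implicit.
Unset Printing Implicit Defensive.

(* MathComp shadows some of these names, such as [opp] and [classes]. *)
Import Defs.

(** * Counting equivalence classes by representatives *)

Section ClassRepresentatives.
Variables (T : finType) (r : rel T) (key : T -> T).
Hypotheses (r_sym : symmetric r) (key_connect : forall x, connect r x (key x)).
Hypothesis r_key : forall x y, r x y -> key x = key y.

Lemma connect_key x y : connect r x y -> key x = key y.
Proof.
case/connectP=> p; elim: p x => [|z p IH] x /=; first by move=> _ ->.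
by case/andP=> /r_key-> /IH.
Qed.

(** [key] stays inside the class of its argument and is constant along [r], so it selects exactly
    one element of each class. *)
Lemma card_classes_key : #|classes r| = #|[set key x | x : T]|.
Proof.
have cE x y : connect r x y -> [set z | connect r x z] = [set z | connect r y z].
  by move=> xy; apply/setP=> z; rewrite !inE (same_connect (sym_connect_sym r_sym) xy).
have -> : classes r
    = [set [set z | connect r x z] | x in [set key x | x : T]].
  rewrite -imset_comp; apply: eq_imset => x; exact: cE.
rewrite card_in_imset // => _ _ /imsetP[x _ ->] /imsetP[y _ ->] /setP/(_ (key y)).
rewrite !inE connect0 => /(connect_trans (key_connect x)) h.
by apply: connect_key; apply: connect_trans h _; rewrite (sym_connect_sym r_sym).
Qed.

End ClassRepresentatives.

Lemma card_classes_root (T : finType) (r : rel T) : symmetric r ->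
  #|classes r| = #|[set fingraph.root r x | x : T]|.
Proof.
move=> r_sym; apply: card_classes_key => // [x|x y /connect1 xy].
  exact: connect_root.
by apply/eqP; rewrite root_connect //; exact: sym_connect_sym.
Qed.

(** * Boundary and internal 0-cells of one surface *)

Section InternalVertices.
Variables (S : ccs_data) (n m : nat).
Hypothesis ok : is_ccs S n m.
Local Notation vertex x := [set y | connect (corner (@nxt S) (@opp S)) x y].

(** Every boundary side occurs exactly once on the contour, and the left and right walls consist of
    cut 1-cells, so only the bottom and top edges contribute. *)
Lemma card_bdry : #|[pred x : side S | bdry x]| = n + m.
Proof.
have b0 w : cut_side_ok w -> count (@bdry S) w = 0.
  case/andP=> _; rewrite all_predC => /negbTE h.
  by apply/eqP; rewrite eqn0Ngt -has_count h.
have -> : #|[pred x : side S | bdry x]| = #|[seq x <- contour S | bdry x]|.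
  apply: eq_card => x; rewrite mem_filter inE.
  by case: (boolP (bdry x)) => //= /(bdry_contour ok)->.
rewrite (card_uniqP _) ?filter_uniq ?(contour_uniq ok) // size_filter.
rewrite /contour !count_cat !count_rev (b0 _ (lside_ok ok)) (b0 _ (rside_ok ok)).
by rewrite addn0 add0n -!size_filter (eqP (in_size ok)) (eqP (out_size ok)).
Qed.

(** The 0-cells that are not internal correspond bijectively to the boundary sides: [bdry_loop]
    makes both end points of a boundary 1-cell the same 0-cell, and [corner_bdry_uniq] lets at most
    one boundary side start there. *)
Lemma card_cells0_internal :
  #|cells0 (@nxt S) (@opp S)| = #|internal_vertices S| + (n + m).
Proof.
have csym := corner_csym (@nxt S) (@opp S).
rewrite -(cardsID (internal_vertices S)); congr (_ + _).
  by apply: eq_card => X; rewrite !inE andbA andbb.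
rewrite -card_bdry -(@card_in_imset _ _ (fun x => vertex x) [pred x | bdry x]); last first.
  move=> x y /eqP bx /eqP by_ /setP/(_ y); rewrite !inE connect0.
  exact: (corner_bdry_uniq (nxt_inj ok) (oppK ok)).
apply: eq_card => X; rewrite !inE; apply/andP/imsetP.
  case=> + /imsetP[x _ eX]; rewrite eX imset_f //= => /forallPn[b].
  rewrite negb_imply => /andP[bb]; rewrite -negb_or negbK !inE => h.
  (* [h] gives [b] or [nxt b] in the 0-cell of [x]; the loop property brings the second case back to
     [b]. *)
  have xb : connect (corner (@nxt S) (@opp S)) x b.
    case/orP: h => // h; apply: connect_trans h _; rewrite csym.
    exact: (bdry_loop ok).
  by exists b => //; apply/setP=> y; rewrite !inE (same_connect csym xb).
case=> b bb ->; rewrite imset_f //; split=> //=.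
apply/forallPn; exists b; rewrite negb_imply; apply/andP; split=> //.
by rewrite !inE connect0.
Qed.

End InternalVertices.

(** * The 0-cells of the glued surface *)

Section Gluing.
Variables (S1 S2 : ccs_data) (n m p : nat).
Hypotheses (ok1 : is_ccs S1 n m) (ok2 : is_ccs S2 m p).
Local Notation S := (glue_data S1 S2).
Local Notation c1 := (corner (@nxt S1) (@opp S1)).
Local Notation c2 := (corner (@nxt S2) (@opp S2)).
Local Notation cS := (corner (@nxt S) (@opp S)).

Let L : side S1 -> side S := inl.
Let R : side S2 -> side S := inr.
Let L_inj : injective L. Proof. by move=> ? ? []. Qed.
Let R_inj : injective R. Proof. by move=> ? ? []. Qed.

Let c1C : connect_sym c1. Proof. exact: corner_csym. Qed.
Let c2C : connect_sym c2. Proof. exact: corner_csym. Qed.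
Let cSC : connect_sym cS. Proof. exact: corner_csym. Qed.

Lemma out_sides_bdry t : t \in out_sides S1 -> bdry t.
Proof. by rewrite mem_filter => /andP[]. Qed.

Lemma in_sides_bdry b : b \in in_sides S2 -> bdry b.
Proof. by rewrite mem_filter => /andP[]. Qed.

Lemma uniq_out_sides : uniq (out_sides S1).
Proof.
apply: filter_uniq; have := contour_uniq ok1.
by rewrite /contour !cat_uniq rev_uniq => /and3P[_ _ /and3P[_ _ /andP[]]].
Qed.

Lemma uniq_in_sides : uniq (in_sides S2).
Proof.
by apply: filter_uniq; have := contour_uniq ok2; rewrite cat_uniq => /andP[].
Qed.

Lemma size_glued : size (in_sides S2) = size (out_sides S1).
Proof. by rewrite (eqP (in_size ok2)) (eqP (out_size ok1)). Qed.

Lemma bottom_glue_bdry x : x \in bottom S1 -> bdry (L x) = bdry x.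
Proof.
move=> xb; suff xo : x \notin out_sides S1.
  by rewrite -[LHS]/(opp (L x) == L x) (glue_oppLn ok1 ok2 xo) (inj_eq L_inj).
(* A side on both the bottom and the top edge would occur twice on the contour. *)
rewrite mem_filter; apply/negP=> /andP[_ xt].
have := contour_uniq ok1; rewrite /contour cat_uniq => /and3P[_ /hasPn/(_ x) + _].
by rewrite !mem_cat mem_rev xt orbT => /(_ isT); rewrite /= xb.
Qed.

Lemma top_glue_bdry x : x \in top S2 -> bdry (R x) = bdry x.
Proof.
move=> xt; suff xo : x \notin in_sides S2.
  by rewrite -[LHS]/(opp (R x) == R x) (glue_oppRn ok1 ok2 xo) (inj_eq R_inj).
rewrite mem_filter; apply/negP=> /andP[_ xb].
have := contour_uniq ok2; rewrite /contour cat_uniq => /and3P[_ /hasPn/(_ x) + _].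
by rewrite !mem_cat mem_rev xt orbT => /(_ isT); rewrite /= xb.
Qed.

Lemma in_sides_glue : in_sides S = map L (in_sides S1).
Proof.
rewrite /in_sides /= filter_map; congr map; apply: eq_in_filter => x.
exact: bottom_glue_bdry.
Qed.

Lemma out_sides_glue : out_sides S = map R (out_sides S2).
Proof.
rewrite /out_sides /= filter_map; congr map; apply: eq_in_filter => x.
exact: top_glue_bdry.
Qed.

(** A corner passes through a side [z] with [opp z != z]; such a side is not an out side, so gluing
    leaves its opposite unchanged. *)
Lemma corner_glueL x y : c1 x y -> cS (L x) (L y).
Proof.
have no z : opp z != z -> z \notin out_sides S1.
  by apply: contra => /out_sides_bdry.
rewrite cornerE; case/orP=> /andP[h /eqP->]; rewrite cornerE;
  rewrite (glue_oppLn ok1 ok2 (no _ h)) (inj_eq L_inj) h /= eqxx //.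
by rewrite orbT.
Qed.

Lemma corner_glueR x y : c2 x y -> cS (R x) (R y).
Proof.
have no z : opp z != z -> z \notin in_sides S2.
  by apply: contra => /in_sides_bdry.
rewrite cornerE; case/orP=> /andP[h /eqP->]; rewrite cornerE;
  rewrite (glue_oppRn ok1 ok2 (no _ h)) (inj_eq R_inj) h /= eqxx //.
by rewrite orbT.
Qed.

Lemma connect_glueL x y : connect c1 x y -> connect cS (L x) (L y).
Proof.
case/connectP=> q; elim: q x => [|z q IH] x /=; first by move=> _ ->; rewrite connect0.
by case/andP=> /corner_glueL/connect1 xz /IH{}IH /IH; exact: connect_trans.
Qed.

Lemma connect_glueR x y : connect c2 x y -> connect cS (R x) (R y).
Proof.
case/connectP=> q; elim: q x => [|z q IH] x /=; first by move=> _ ->; rewrite connect0.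
by case/andP=> /corner_glueR/connect1 xz /IH{}IH /IH; exact: connect_trans.
Qed.

(** Crossing the glued 1-cell leads from [R b] to [L (nxt t)], and the boundary loop of [S1] at [t]
    identifies [nxt t] with [t]. *)
Lemma connect_glued t b : b \in in_sides S2 -> opp (R b) = L t ->
  connect cS (R b) (L t).
Proof.
move=> bi e; have [t' to [_]] := glue_oppRP ok1 ok2 bi.
rewrite -/(R b) e => -[et]; rewrite -et in to.
apply: (connect_trans (y := L (nxt t))).
  by apply: connect1; rewrite cornerE e /= eqxx.
by rewrite cSC; apply: connect_glueL; exact: (bdry_loop ok1 (out_sides_bdry to)).
Qed.

(* A representative of the 0-cell of a side of the glued surface: 0-cells of
   [S2] on the glued boundary are represented in [S1]. *)
Definition glue_key (x : side S) : side S :=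
  match x with
  | inl x => L (fingraph.root c1 x)
  | inr y => if [pick b in in_sides S2 | connect c2 y b] is Some b
             then if opp (R b) is inl t then L (fingraph.root c1 t) else R (fingraph.root c2 y)
             else R (fingraph.root c2 y)
  end.

(** At most one in side starts at a 0-cell of [S2], so the choice made by [pick] in [glue_key] is
    forced to be [b]. *)
Lemma glue_keyR_near y t b : b \in in_sides S2 -> opp (R b) = L t ->
  connect c2 y b -> glue_key (R y) = L (fingraph.root c1 t).
Proof.
move=> bi e yb; rewrite /glue_key /R /=; case: pickP => [b' /andP[bi' yb']|/(_ b)].
  have <- : b = b'.
    apply: (corner_bdry_uniq (nxt_inj ok2) (oppK ok2)).
    - exact/eqP/in_sides_bdry.
    - exact/eqP/in_sides_bdry.
    - by rewrite -(same_connect c2C yb).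
  by have := e; rewrite /= => ->.
by rewrite bi yb.
Qed.

Lemma glue_keyR_far y : ~~ has (connect c2 y) (in_sides S2) ->
  glue_key (R y) = R (fingraph.root c2 y).
Proof.
move=> /hasPn h; rewrite /glue_key /R /=; case: pickP => [b /andP[/h/negbTE->]|] //.
Qed.

Lemma glue_key_connect x : connect cS x (glue_key x).
Proof.
case: x => [x|y]; first exact/connect_glueL/connect_root.
rewrite -/(R y); case: (boolP (has (connect c2 y) (in_sides S2))) => [/hasP[b bi yb]|h].
  have [t _ [_ e]] := glue_oppRP ok1 ok2 bi.
  rewrite (glue_keyR_near bi e yb); apply: connect_trans (connect_glueR yb) _.
  by apply: connect_trans (connect_glued bi e) _; exact/connect_glueL/connect_root.
by rewrite glue_keyR_far //; exact/connect_glueR/connect_root.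
Qed.

(** Across a glued 1-cell, the boundary loops of [S1] and [S2] show that both sides get the root of
    the same out side; elsewhere the corner already exists in one of the pieces. *)
Lemma glue_key_nxt_opp x : opp x != x -> glue_key x = glue_key (nxt (opp x)).
Proof.
case: x => [x|y]; rewrite -/(L _) -/(R _).
  case: (boolP (x \in out_sides S1)) => [xo _|xo].
    have [b bi [e e']] := glue_oppLP ok1 ok2 xo.
    rewrite -/(L x) in e e'; rewrite e (@glue_keyR_near (nxt b) x b) //.
    by rewrite c2C; exact: (bdry_loop ok2 (in_sides_bdry bi)).
  rewrite (glue_oppLn ok1 ok2 xo) (inj_eq L_inj) => h.
  congr L; apply/eqP; rewrite root_connect //.
  by apply: connect1; rewrite cornerE h eqxx.
case: (boolP (y \in in_sides S2)) => [yi _|yi].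
  have [t to [_ e]] := glue_oppRP ok1 ok2 yi; rewrite -/(R y) in e.
  rewrite e (glue_keyR_near yi e) ?connect0 //.
  congr L; apply/eqP; rewrite root_connect //.
  exact: (bdry_loop ok1 (out_sides_bdry to)).
rewrite (glue_oppRn ok1 ok2 yi) (inj_eq R_inj) => h.
have yz : connect c2 y (nxt (opp y)) by apply: connect1; rewrite cornerE h eqxx.
change (nxt (inr (opp y) : side S)) with (R (nxt (opp y))).
rewrite /glue_key /R; have -> : fingraph.root c2 (nxt (opp y)) = fingraph.root c2 y.
  by apply/eqP; rewrite eq_sym root_connect.
(* [y] and [nxt (opp y)] lie in the same 0-cell, so [pick] tests the same predicate for both. *)
by under [in RHS]eq_pick do rewrite -(same_connect c2C yz).
Qed.

Lemma glue_key_corner x y : cS x y -> glue_key x = glue_key y.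
Proof.
by rewrite cornerE => /orP[] /andP[/glue_key_nxt_opp h /eqP->]; rewrite h.
Qed.

(** The keys are all roots of [S1] and those roots of [S2] that are off the in boundary. The roots
    of [S2] that disappear belong to the [m] in sides, which have distinct 0-cells. *)
Lemma card_cells0_glue :
  #|cells0 (@nxt S1) (@opp S1)| + #|cells0 (@nxt S2) (@opp S2)|
  = #|cells0 (@nxt S) (@opp S)| + m.
Proof.
rewrite /cells0 (card_classes_key (corner_sym _ _) glue_key_connect glue_key_corner).
rewrite !(card_classes_root (corner_sym _ _)).
pose far := [set y | ~~ has (connect c2 y) (in_sides S2)].
have -> : [set glue_key x | x : side S]
  = L @: [set fingraph.root c1 x | x : side S1] :|: R @: [set fingraph.root c2 y | y in far].
  apply/setP=> z; rewrite inE; apply/imsetP/orP.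
    case=> -[x|y] _ ->; rewrite -/(L _) -/(R _).
      by left; apply/imset_f/imset_f.
    case: (boolP (has (connect c2 y) (in_sides S2))) => [/hasP[b bi yb]|h].
      have [t _ [_ e]] := glue_oppRP ok1 ok2 bi; left.
      by rewrite (glue_keyR_near bi e yb); apply/imset_f/imset_f.
    by right; rewrite glue_keyR_far //; apply/imset_f/imset_f; rewrite inE.
  case=> /imsetP[_ /imsetP[x xf ->] ->]; first by exists (L x).
  by exists (R x) => //; rewrite glue_keyR_far //; rewrite inE in xf.
rewrite cardsU disjoint_setI0 ?cards0 ?subn0; last first.
  rewrite -setI_eq0; apply/eqP/setP=> z; rewrite !inE.
  by apply/negP=> /andP[/imsetP[x _ ->] /imsetP[y _]].
rewrite (card_imset _ L_inj) (card_imset _ R_inj) -addnA; congr (_ + _).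
(* The roots of [S1] have cancelled; it remains to split those of [S2] into the far ones and the [m]
   on the in boundary. *)
have -> : [set fingraph.root c2 y | y : side S2]
  = [set fingraph.root c2 y | y in far] :|: [set fingraph.root c2 y | y in in_sides S2].
  apply/setP=> z; rewrite inE; apply/imsetP/orP.
    case=> y _ ->; case: (boolP (y \in far)) => yf; first by left; apply: imset_f.
    move: yf; rewrite inE negbK => /hasP[b bi yb]; right; apply/imsetP.
    by exists b => //; apply/eqP; rewrite root_connect.
  by case=> /imsetP[y _ ->]; exists y.
rewrite cardsU disjoint_setI0 ?cards0 ?subn0; last first.
  rewrite -setI_eq0; apply/eqP/setP=> z; rewrite !inE.
  apply/negP=> /andP[/imsetP[y yf ->] /imsetP[b bi /eqP]].
  rewrite root_connect // => yb; move: yf; rewrite inE => /hasPn/(_ b bi).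
  by rewrite yb.
congr (_ + _); rewrite card_in_imset.
  by rewrite (card_uniqP uniq_in_sides) (eqP (in_size ok2)).
move=> b b' /in_sides_bdry/eqP ob /in_sides_bdry/eqP ob' /eqP.
by rewrite root_connect //; exact: (corner_bdry_uniq (nxt_inj ok2) (oppK ok2)).
Qed.

End Gluing.

(** * Colourings as functions on sides *)

Section SideColourings.
Variables (gT : finGroupType) (S : ccs_data).
Implicit Type f : {ffun side S -> gT}.

Definition is_flat f : bool :=
  [forall x, (\prod_(y <- fingraph.orbit (@nxt S) x)
                (if pos y then f y else (f y)^-1) == 1)%g].

(* A colouring of the 1-cells, as a function of sides that does not depend on
   the chosen side of a 1-cell. *)
Definition side_colourings (g h : seq gT) : {set {ffun side S -> gT}} :=
  [set f : {ffun side S -> gT} | [&& [forall x : side S, f (opp x) == f x], is_flat f,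
               map f (in_sides S) == g & map f (out_sides S) == h]].

Lemma edge_of_opp (x : side S) : involutive (@opp S) ->
  edge_of (opp x) = edge_of x.
Proof.
move=> oppK; apply/val_inj/setP=> y; rewrite !inE -(@same_fconnect1 _ (@opp S)) //.
exact: inv_inj.
Qed.

(** Composition with [edge_of] is injective because every edge has a side, and its image consists of
    the functions invariant under [opp]. *)
Lemma card_colourings (g h : seq gT) : involutive (@opp S) ->
  #|colourings S g h| = #|side_colourings g h|.
Proof.
move=> oppK; pose F (c : {ffun edge S -> gT}) := [ffun x : side S => c (edge_of x)].
have edgeP (e : edge S) : exists x, e = edge_of x.
  by case: e => E i; have /imsetP[x _ eE] := i; exists x; apply/val_inj.
have F_inj : injective F.
  move=> c c' /ffunP eF; apply/ffunP=> e; have [x ->] := edgeP e.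
  by have := eF x; rewrite !ffunE.
rewrite -(card_imset _ F_inj); apply: eq_card => f.
have mapF c s : map (F c) s = [seq c (edge_of x) | x <- s].
  by apply: eq_map => x; rewrite ffunE.
have flatF c : is_flat (F c) = is_colouring c.
  apply: eq_forallb => x; congr (_ == _); apply: eq_bigr => y _.
  by rewrite /signed_colour !ffunE.
apply/imsetP/idP=> [[c + ->]|].
  rewrite !inE !mapF flatF => ->; rewrite andbT.
  by apply/forallP=> x; rewrite !ffunE edge_of_opp.
rewrite inE => /andP[/forallP f_opp fP].
(* The inverse reads the colour from any side of the 1-cell; the default [1] is never reached, as a
   1-cell has at least one side. *)
pose c := [ffun e : edge S => odflt 1%g (omap f [pick x in val e])].
have f_connect x y : fconnect (@opp S) x y -> f y = f x.
  case/connectP=> q; elim: q x => [|z q IH] x /=; first by move=> _ ->.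
  by case/andP=> /eqP<- /IH{}IH /IH->; exact/eqP.
suff eF : f = F c by exists c => //; rewrite inE -flatF -!mapF -eF.
apply/ffunP=> x; rewrite !ffunE; case: pickP => [y|/(_ x)] /=.
  by rewrite inE => /f_connect->.
by rewrite inE connect0.
Qed.

End SideColourings.

(** Applied to the inclusions of the two pieces, this shows that gluing leaves the 2-cells and their
    boundary words unchanged. *)
Lemma orbit_map (T T' : finType) (f : T -> T) (f' : T' -> T') (j : T -> T') x :
  injective j -> (forall y, f' (j y) = j (f y)) ->
  fingraph.orbit f' (j x) = map j (fingraph.orbit f x).
Proof.
move=> j_inj fj; have iterj k y : iter k f' (j y) = j (iter k f y).
  by elim: k => //= k ->.
have trajj k y : traject f' (j y) k = map j (traject f y k).
  by elim: k y => //= k IH y; rewrite fj IH.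
rewrite /fingraph.orbit -trajj; congr traject.
rewrite /fingraph.order -(card_image j_inj (fconnect f x)); apply: eq_card => z.
apply/idP/imageP=> [/iter_findex<-|[y xy ->]].
  by exists (iter (findex f' (j x) z) f x); rewrite ?iterj //; exact: fconnect_iter.
by rewrite -(iter_findex xy) -iterj; exact: fconnect_iter.
Qed.

(** * Colourings of the glued surface *)

Section GlueColourings.
Variables (gT : finGroupType) (S1 S2 : ccs_data) (n m p : nat).
Hypotheses (ok1 : is_ccs S1 n m) (ok2 : is_ccs S2 m p).
Local Notation S := (glue_data S1 S2).

Let L : side S1 -> side S := inl.
Let R : side S2 -> side S := inr.
Let L_inj : injective L. Proof. by move=> ? ? []. Qed.
Let R_inj : injective R. Proof. by move=> ? ? []. Qed.

Definition glue_colouring (u : {ffun side S1 -> gT} * {ffun side S2 -> gT}) :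
  {ffun side S -> gT} :=
  [ffun x => match x with inl x => u.1 x | inr y => u.2 y end].

Lemma glue_colouring_bij : bijective glue_colouring.
Proof.
exists (fun f : {ffun side S -> gT} => ([ffun x => f (L x)], [ffun y => f (R y)])).
  by case=> f1 f2; congr (_, _); apply/ffunP=> x; rewrite !ffunE.
by move=> f; apply/ffunP=> -[x|y]; rewrite !ffunE.
Qed.

Lemma glue_opp_nth x0 y0 i : i < m ->
  opp (L (nth x0 (out_sides S1) i)) = R (nth y0 (in_sides S2) i) /\
  opp (R (nth y0 (in_sides S2) i)) = L (nth x0 (out_sides S1) i).
Proof.
move=> i_m; have io : i < size (out_sides S1) by rewrite (eqP (out_size ok1)).
have ii : i < size (in_sides S2) by rewrite (eqP (in_size ok2)).
split; rewrite /= index_uniq ?(uniq_out_sides ok1) ?(uniq_in_sides ok2) //.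
  exact: nth_map.
exact: nth_map.
Qed.

(** On the glued 1-cells invariance becomes the agreement of the two lists of colours. In the pieces
    these sides are fixed by [opp], so there the condition is vacuous. *)
Lemma glue_colouring_opp u :
  [forall x : side S, glue_colouring u (opp x) == glue_colouring u x]
  = [&& [forall x : side S1, u.1 (opp x) == u.1 x],
        [forall x : side S2, u.2 (opp x) == u.2 x]
      & map u.2 (in_sides S2) == map u.1 (out_sides S1)].
Proof.
pose f := glue_colouring u.
have fL x : f (L x) = u.1 x by rewrite ffunE.
have fR y : f (R y) = u.2 y by rewrite ffunE.
apply/forallP/and3P=> [f_opp|[/forallP u1_opp /forallP u2_opp /eqP e]].
  split.
  - apply/forallP=> x; case: (boolP (x \in out_sides S1)) => [/out_sides_bdry/eqP->//|xo].
    by have := f_opp (L x); rewrite (glue_oppLn ok1 ok2 xo) -/f !fL.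
  - apply/forallP=> y; case: (boolP (y \in in_sides S2)) => [/in_sides_bdry/eqP->//|yi].
    by have := f_opp (R y); rewrite (glue_oppRn ok1 ok2 yi) -/f !fR.
  apply/eqP/(@eq_from_nth _ 1%g); rewrite !size_map ?(size_glued ok1 ok2) // => i i_m.
  (* Since [i] is in range, neither list is empty, which supplies default values for [nth]. *)
  have x0 : side S1 by case: (out_sides S1) i_m.
  have y0 : side S2 by move: i_m; rewrite -(size_glued ok1 ok2); case: (in_sides S2).
  rewrite (nth_map y0) ?(size_glued ok1 ok2) // (nth_map x0) //.
  rewrite (eqP (out_size ok1)) in i_m; have [e _] := glue_opp_nth x0 y0 i_m.
  by have := f_opp (L (nth x0 (out_sides S1) i)); rewrite e -/f fL fR => /eqP.
have u_glued x0 y0 i : i < m ->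
    u.2 (nth y0 (in_sides S2) i) = u.1 (nth x0 (out_sides S1) i).
  move=> i_m; rewrite -(nth_map y0 1%g) ?(eqP (in_size ok2)) // e.
  by rewrite (nth_map x0) // (eqP (out_size ok1)).
case=> [x|y]; rewrite -/(L _) -/(R _) -/f.
  case: (boolP (x \in out_sides S1)) => [xo|xo]; last first.
    by rewrite (glue_oppLn ok1 ok2 xo) !fL.
  (* Only the existence of an in side is taken from this, as a default value for [nth]. *)
  have [y0 _ _] := glue_oppLP ok1 ok2 xo.
  have := xo; rewrite -index_mem (eqP (out_size ok1)) => i_m.
  have [] := glue_opp_nth x y0 i_m; rewrite nth_index // => -> _.
  by rewrite fL fR (u_glued x) // nth_index.
case: (boolP (y \in in_sides S2)) => [yi|yi]; last first.
  by rewrite (glue_oppRn ok1 ok2 yi) !fR.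
have [x0 _ _] := glue_oppRP ok1 ok2 yi.
have := yi; rewrite -index_mem (eqP (in_size ok2)) => i_m.
have [] := glue_opp_nth x0 y i_m; rewrite nth_index // => _ ->.
by rewrite fL fR -(u_glued _ y) // nth_index.
Qed.

Lemma glue_colouring_flat u :
  is_flat (glue_colouring u) = is_flat u.1 && is_flat u.2.
Proof.
have eL x : (\prod_(y <- fingraph.orbit (@nxt S) (L x))
      (if pos y then glue_colouring u y else (glue_colouring u y)^-1)
    = \prod_(y <- fingraph.orbit (@nxt S1) x) (if pos y then u.1 y else (u.1 y)^-1))%g.
  rewrite (orbit_map _ L_inj (f := @nxt S1)) // big_map.
  by apply: eq_bigr => y _; rewrite ffunE.
have eR x : (\prod_(y <- fingraph.orbit (@nxt S) (R x))
      (if pos y then glue_colouring u y else (glue_colouring u y)^-1)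
    = \prod_(y <- fingraph.orbit (@nxt S2) x) (if pos y then u.2 y else (u.2 y)^-1))%g.
  rewrite (orbit_map _ R_inj (f := @nxt S2)) // big_map.
  by apply: eq_bigr => y _; rewrite ffunE.
apply/forallP/andP=> [flat|[/forallP flat1 /forallP flat2] [x|y]].
- split; apply/forallP=> x; first by rewrite -eL; exact: flat.
  by rewrite -eR; exact: flat.
- by rewrite eL.
- by rewrite eR.
Qed.

(** The agreement condition on the glued 1-cells is absorbed as the in-boundary condition on [u.2],
    once [k] is read off [u.1]. *)
Lemma glue_colouringE (g h : seq gT)
    (u : {ffun side S1 -> gT} * {ffun side S2 -> gT}) (k := map u.1 (out_sides S1)) :
  (glue_colouring u \in side_colourings S g h)
  = (u.1 \in side_colourings S1 g k) && (u.2 \in side_colourings S2 k h).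
Proof.
rewrite !inE glue_colouring_opp glue_colouring_flat.
rewrite (in_sides_glue ok1 ok2) (out_sides_glue ok1 ok2) -!map_comp eqxx andbT.
have -> : map (glue_colouring u \o L) (in_sides S1) = map u.1 (in_sides S1).
  by apply: eq_map => x; rewrite /= ffunE.
have -> : map (glue_colouring u \o R) (out_sides S2) = map u.2 (out_sides S2).
  by apply: eq_map => x; rewrite /= ffunE.
rewrite -/k; apply/idP/idP.
  by case/and4P=> /and3P[-> -> ->] /andP[-> ->] -> ->.
by case/andP=> /and3P[-> -> ->] /and4P[-> -> -> ->].
Qed.

Lemma card_side_colourings_glue (g h : seq gT) :
  #|side_colourings S g h|
  = \sum_(k : m.-tuple gT)
      #|side_colourings S2 k h| * #|side_colourings S1 g k|.
Proof.
have out_sizeP (f : {ffun side S1 -> gT}) : size (map f (out_sides S1)) == m.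
  by rewrite size_map (out_size ok1).
pose out (u : {ffun side S1 -> gT} * {ffun side S2 -> gT}) :=
  Tuple (out_sizeP u.1).
rewrite -sum1_card (reindex _ (onW_bij _ glue_colouring_bij)).
rewrite (partition_big out xpredT) //; apply: eq_bigr => k _.
(* The fibre over [k] is a product of two sets of colourings; a pair whose out colours differ from
   [k] is in neither the fibre nor the product. *)
rewrite mulnC -cardsX -sum1_card; apply: eq_bigl => -[u1 u2].
rewrite glue_colouringE in_setX; have [<- //|uk] := eqVneq (out (u1, u2)) k.
  by rewrite andbT.
rewrite andbF; apply/esym/negP=> /andP[]; rewrite inE => /and4P[_ _ _ /eqP e] _.
by case/negP: uk; apply/eqP/val_inj.
Qed.

End GlueColourings.

(** * Normalisation and the gluing formula *)

Lemma card_internal_vertices_glue (n m p : nat) (m_gt0 : 0 < m)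
    (M1 : ccs n m) (M2 : ccs m p) :
  #|internal_vertices (glue m_gt0 M2 M1)|
  = #|internal_vertices M1| + #|internal_vertices M2| + m.
Proof.
(* With one 0-cell per boundary component, the count reads (v1 + n + m) + (v2 + m + p) = (v + n + p)
   + m. *)
have := card_cells0_glue (ccs_ok M1) (ccs_ok M2).
rewrite (card_cells0_internal (ccs_ok M1)) (card_cells0_internal (ccs_ok M2)).
rewrite (card_cells0_internal (ccs_ok (glue m_gt0 M2 M1))) /=; lia.
Qed.

Lemma card_colourings_glue (gT : finGroupType) (n m p : nat) (m_gt0 : 0 < m)
    (M1 : ccs n m) (M2 : ccs m p) (g h : seq gT) :
  #|colourings (glue m_gt0 M2 M1) g h|
  = \sum_(k : m.-tuple gT) #|colourings M2 k h| * #|colourings M1 g k|.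
Proof.
rewrite (card_colourings _ _ (oppK (ccs_ok _))).
rewrite (card_side_colourings_glue (ccs_ok M1) (ccs_ok M2)).
by apply: eq_bigr => k _; rewrite !card_colourings //; exact: oppK (ccs_ok _).
Qed.

Import GRing.Theory Num.Theory.
Local Open Scope ring_scope.

Theorem mainTheorem3 (R : realType) (gT : finGroupType) (n m p : nat)
    (m_gt0 : (0 < m)%N) (M1 : ccs n m) (M2 : ccs m p) :
  (forall (g : n.-tuple gT) (i : p.-tuple gT),
     matrix_elt R i (glue m_gt0 M2 M1) g
     = \sum_(h : m.-tuple gT) matrix_elt R i M2 h * matrix_elt R h M1 g)
  /\ (forall u : boundary_space R gT n,
        Z (glue m_gt0 M2 M1) u = Z M2 (Z M1 u)).
Proof.
have gluing (g : n.-tuple gT) (i : p.-tuple gT) :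
    matrix_elt R i (glue m_gt0 M2 M1) g
    = \sum_(h : m.-tuple gT) matrix_elt R i M2 h * matrix_elt R h M1 g.
  have G_neq0 : #|gT|%:R != 0 :> R.
    by rewrite pnatr_eq0 -lt0n; apply/card_gt0P; exists 1%g.
  rewrite /matrix_elt card_colourings_glue natr_sum mulr_sumr.
  apply: eq_bigr => h _; rewrite natrM mulrACA -invfM; congr (_^-1 * _).
  (* Multiplying the normalising factors adds their exponents, which is valid because |G| is
     nonzero. *)
  rewrite -powRD ?G_neq0 ?implybT // card_internal_vertices_glue !natrD.
  by congr (_ `^ _); field.
split=> // u; apply/ffunP=> i; rewrite !ffunE.
under [RHS]eq_bigr do rewrite ffunE mulr_sumr.
(* Composing the linear maps is matrix multiplication after the sums over [g] and [h] are
   exchanged. *)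
rewrite exchange_big; apply: eq_bigr => g _.
by rewrite gluing mulr_suml; apply: eq_bigr => h _; rewrite mulrA.
Qed.
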